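(* Let $f$ be the solution of $\partial_t f=\mathcal L(f)$, $f(0)=f_0\in L^2(\Omega,\omega)$, and let $y^{\rm GAP}(T)$ be the numerical solution at the final time $T=N\Delta t$, $N\in\mathbb N$, obtained by applying $N$ successive steps of size $\Delta t$ of the Galerkin Alternating Projection (GAP) scheme starting from $\Pi_{\mathcal M_r}(f_0)\in\mathcal M_r^\omega$. Then $$\|y^{\rm GAP}(T)-f(T)\|\lesssim \Delta t+\eta+\delta_0 .$$
   Context: Setting. $\Omega=\Omega_1\times\Omega_2$ is a (compact) Cartesian product set with product measure $\omega=\omega_1\cdot\omega_2$ (each factor may be discrete or continuous); $\|\cdot\|=\|\cdot\|_\omega$ is the norm of $L^2(\Omega,\omega)$ (real-valued functions). A function $f$ has rank $r$ if $r$ is the minimal number such that $f(\xi_1,\xi_2)=\sum_{i,j=1}^r S_{ij}X_i(\xi_1)V_j(\xi_2)$; one writes $f=\mathbf X\mathbf S\mathbf V^\top$ with $\mathbf X=[X_1|\dots|X_r]$ orthonormal in $L^2(\Omega_1,\omega_1)$, $\mathbf V=[V_1|\dots|V_r]$ orthonormal in $L^2(\Omega_2,\omega_2)$, $\mathbf S\in\mathbb R^{r\times r}$. $\mathcal M_r^\omega$ is the set of functions of rank $r$ in $L^2(\Omega,\omega)$, and $\Pi_{\mathcal M_r}(g)$ denotes the best approximation of $g$ in $\mathcal M_r^\omega$. Projectors. For such orthonormal systems, $$\mathcal P_{\mathbf X}[g]=\sum_{i=1}^r X_i(\xi_1)\int_{\Omega_1}X_i(\eta)g(\eta,\xi_2)\,d\omega_1(\eta),\qquad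 \mathcal P_{\mathbf V}[g]=\sum_{j=1}^r\Big(\int_{\Omega_2} g(\xi_1,\eta)V_j(\eta)\,d\omega_2(\eta)\Big)V_j(\xi_2).$$ For $f=\mathbf X\mathbf S\mathbf V^\top\in\mathcal M_r^\omega$, the orthogonal projector onto the tangent space of $\mathcal M_r^\omega$ at $f$ is $\mathcal P(f)=\mathcal P_{\mathbf X}-\mathcal P_{\mathbf X}\circ\mathcal P_{\mathbf V}+\mathcal P_{\mathbf V}$, and $\mathcal P^\perp(f)=\mathrm{Id}-\mathcal P(f)$. Assumptions. (1) $\mathcal L$ is bounded and Lipschitz: $\|\mathcal L(f)\|\le B$, $\|\mathcal L(f)-\mathcal L(g)\|\le C\|f-g\|$ for all $f,g\in L^2(\Omega,\omega)$. (2) $\|\mathcal P^\perp(f)[\mathcal L(f)]\|\le\eta$ for all $f\in\mathcal M_r^\omega$. (3) $\delta_0:=\|f_0-\Pi_{\mathcal M_r}(f_0)\|$ is the initial value error. One step of the GAP scheme from $t_n$ to $t_{n+1}=t_n+\Delta t$ with input $y_n=\mathbf X_0\mathbf S_0\mathbf V_0^\top\in\mathcal M_r^\omega$: (i) solve $\partial_t\ell=\mathcal P_{\mathbf X_0}[\mathcal L(\ell)]$, $\ell(t_n)=y_n$ on $[t_n,t_{n+1}]$; the solution has the form $\ell(t_{n+1})=\mathbf X_0\mathbf L^\top$ with $\mathbf L=[L_1|\dots|L_r]$ functions of $\xi_2$; let $\mathbf V_1$ be a system of $r$ functions orthonormal with respect to $\omega_2$ obtained by orthonormalizing $L_1,\dots,L_r$;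 (ii) solve $\partial_t k=\mathcal P_{\mathbf V_1}[\mathcal L(k)]$, $k(t_n)=\mathcal P_{\mathbf V_1}[y_n]$ on $[t_n,t_{n+1}]$; the result of the step is $y_{n+1}=k(t_{n+1})=\mathbf X_1\mathbf S_1\mathbf V_1^\top$ (with $\mathbf X_1$ an orthonormal basis with respect to $\omega_1$), which is the input of the next step. As required by the scheme, each $y_n$ belongs to $\mathcal M_r^\omega$. Then $y^{\rm GAP}(T)=y_N$. Notation. $a\lesssim b$ means $a\le K b$ with a constant $K$ independent of $\Delta t$, $N$, $\eta$, $\delta_0$ and of the particular $f_0$ and singular values of the approximations, depending only on $B$, $C$ and $T$. *)

(* Defs.v *)
(* Elements of L^2(mu) are represented by functions [f \in Lfun mu 2%:E]
   (measurable, with finite L^2 norm); equality in L^2 is equality mu-a.e. *)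
From HB Require Import structures.
From mathcomp Require Import all_boot all_order all_algebra.
From mathcomp Require Import all_classical all_reals all_analysis.

Set Implicit Arguments.
Unset Strict Implicit.
Unset Printing Implicit Defensive.

Import Order.TTheory GRing.Theory Num.Theory.
Import numFieldNormedType.Exports.

Local Open Scope classical_set_scope.
Local Open Scope ring_scope.

Section L2.
Context d (T : measurableType d) (R : realType).
Variable mu : {measure set T -> \bar R}.

(* [fine] is harmless on [Lfun mu 2%:E], where the norm is finite. *)
Definition L2norm (f : T -> R) : R := fine ('N[mu]_2%:E[EFin \o f]).

Definition L2_orthonormal r (X : 'I_r -> T -> R) : Prop :=
  (forall i, X i \in Lfun mu 2%:E) /\
  (forall i j, \int[mu]_x (X i x * X j x) = (i == j)%:R).

(* [u] solves u' = F(u), u(a) = u0 on [a, b] in L^2(mu): the difference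
   quotients converge in norm, one-sidedly at the end points. *)
Definition L2_ode_solution (F : (T -> R) -> (T -> R)) (a b : R) (u0 : T -> R)
    (u : R -> T -> R) : Prop :=
  [/\ forall t, t \in `[a, b] -> u t \in Lfun mu 2%:E,
      u a = u0 %[ae mu] &
      forall t, t \in `[a, b] ->
        L2norm ((s - t)^-1 *: (u s - u t) - F (u t))
          @[s --> within `[a, b] t^'] --> 0].

Definition L2_bounded_lipschitz (L : (T -> R) -> (T -> R)) (B C : R) : Prop :=
  [/\ forall f, f \in Lfun mu 2%:E -> L f \in Lfun mu 2%:E,
      forall f, f \in Lfun mu 2%:E -> L2norm (L f) <= B &
      forall f g, f \in Lfun mu 2%:E -> g \in Lfun mu 2%:E ->
        L2norm (L f - L g) <= C * L2norm (f - g)].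

End L2.

Section LowRank.
Context d1 d2 (T1 : measurableType d1) (T2 : measurableType d2) (R : realType).
Variable m1 : {sigma_finite_measure set T1 -> \bar R}.
Variable m2 : {sigma_finite_measure set T2 -> \bar R}.
Local Notation om := (m1 \x m2)%E.
Local Notation fct := ((T1 * T2)%type -> R).

(* X S V^T *)
Definition lowrank r (X : 'I_r -> T1 -> R) (S : 'M[R]_r) (V : 'I_r -> T2 -> R)
    : fct :=
  fun z => \sum_(i < r) \sum_(j < r) S i j * X i z.1 * V j z.2.

Definition has_factorization r (f : fct) : Prop :=
  exists (X : 'I_r -> T1 -> R) (S : 'M[R]_r) (V : 'I_r -> T2 -> R),
    [/\ forall i, X i \in Lfun m1 2%:E,
        forall j, V j \in Lfun m2 2%:E &
        f = lowrank X S V %[ae om]].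

Definition rank_manifold r : set fct :=
  [set f | [/\ f \in Lfun om 2%:E,
               has_factorization r f &
               forall s, (s < r)%N -> ~ has_factorization s f]].

Definition best_approx r (g p : fct) : Prop :=
  rank_manifold r p /\
  forall q, rank_manifold r q -> L2norm om (g - p) <= L2norm om (g - q).

Definition projX r (X : 'I_r -> T1 -> R) (g : fct) : fct :=
  fun z => \sum_(i < r) X i z.1 * \int[m1]_x (X i x * g (x, z.2)).

Definition projV r (V : 'I_r -> T2 -> R) (g : fct) : fct :=
  fun z => \sum_(j < r) (\int[m2]_y (g (z.1, y) * V j y)) * V j z.2.

Definition tangent_proj r (X : 'I_r -> T1 -> R) (V : 'I_r -> T2 -> R)
    (g : fct) : fct :=
  projX X g - projX X (projV V g) + projV V g.

Definition tangent_residual_le r (L : fct -> fct) (eta : R) : Prop :=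
  forall (f : fct) (X : 'I_r -> T1 -> R) (S : 'M[R]_r) (V : 'I_r -> T2 -> R),
    rank_manifold r f ->
    L2_orthonormal m1 X -> L2_orthonormal m2 V -> f = lowrank X S V %[ae om] ->
    L2norm om (L f - tangent_proj X V (L f)) <= eta.

(* [V1] orthonormalizes the system [W] in the sense of a QR factorization
   W = V1 Q: if W is linearly independent both span the same space, otherwise
   [V1] contains an arbitrary completion. *)
Definition orthonormalizes r (V1 W : 'I_r -> T2 -> R) : Prop :=
  L2_orthonormal m2 V1 /\
  exists Q : 'M[R]_r,
    forall i, W i = (fun y => \sum_(j < r) Q i j * V1 j y) %[ae m2].

(* [l] solves the first sub-problem, with final value X0 W^T; [k] the second. *)
Definition gap_step r (L : fct -> fct) (a b : R)
    (X0 : 'I_r -> T1 -> R) (S0 : 'M[R]_r) (V0 : 'I_r -> T2 -> R)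
    (X1 : 'I_r -> T1 -> R) (S1 : 'M[R]_r) (V1 : 'I_r -> T2 -> R) : Prop :=
  exists (l k : R -> fct) (W : 'I_r -> T2 -> R),
    [/\ [/\ L2_ode_solution om (fun g => projX X0 (L g)) a b
              (lowrank X0 S0 V0) l,
            forall i, W i \in Lfun m2 2%:E,
            l b = (fun z => \sum_(i < r) X0 i z.1 * W i z.2) %[ae om] &
            orthonormalizes V1 W],
        L2_ode_solution om (fun g => projV V1 (L g)) a b
          (projV V1 (lowrank X0 S0 V0)) k,
        L2_orthonormal m1 X1 &
        k b = lowrank X1 S1 V1 %[ae om]].

(* N steps of size dt; the n-th approximation is X_n S_n V_n^T. *)
Definition gap_scheme r (L : fct -> fct) (dt : R) (N : nat)
    (X : nat -> 'I_r -> T1 -> R) (S : nat -> 'M[R]_r)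
    (V : nat -> 'I_r -> T2 -> R) : Prop :=
  (forall n, (n <= N)%N ->
     [/\ L2_orthonormal m1 (X n), L2_orthonormal m2 (V n) &
         rank_manifold r (lowrank (X n) (S n) (V n))]) /\
  (forall n, (n < N)%N ->
     gap_step L (n%:R * dt) (n.+1%:R * dt)
       (X n) (S n) (V n) (X n.+1) (S n.+1) (V n.+1)).

End LowRank.

(* Main.v *)
(* Let [y] be the input of a GAP step and [P_X], [P_V] the projectors onto the
   old row basis [X] and the new column basis [V]. The first sub-problem ends at
   [l = y + dt P_X L(y) + O(dt^2)], and [l] lies in the range of [P_V]; the
   second ends at [P_V y + dt P_V L(y) + O(dt^2)]. Hence the step differs from
   the explicit Euler step [y + dt L(y)] by
   [dt (Id - P_V)(Id - P_X) L(y) + O(dt^2)]. Since [(Id - P_V)(Id - P_X)] is the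
   normal projector of the manifold at points with bases [X], [V], and such
   points of full rank exist within [dt] of [l], this defect is at most
   [dt eta + O(dt^2)]. No singular value enters, and no exact flow started on
   the manifold is needed: the exact solution satisfies the same Euler
   recursion up to [O(dt^2)], so a discrete Gronwall argument concludes. *)
Require Import Defs.
From HB Require Import structures.
From mathcomp Require Import all_boot all_order all_algebra.
From mathcomp Require Import all_classical all_reals all_analysis.
From mathcomp Require Import unstable measurable_realfun ring.

Import Order.TTheory GRing.Theory Num.Theory.
Import numFieldNormedType.Exports.

Local Open Scope classical_set_scope.
Local Open Scope ring_scope.

Set Implicit Arguments.
Unset Strict Implicit.
Unset Printing Implicit Defensive.

(** * The seminormed space [L^2] *)

Section L2_basics.
Context d (T : measurableType d) (R : realType).
Variable mu : {measure set T -> \bar R}.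
Implicit Types (f g h : T -> R) (a : R).

Local Notation L2 := (Lfun mu 2%:E).
Local Notation N := (L2norm mu).

(** Trades the real powers inside the norm for plain squares, the form in which Tonelli is applied
    to sections. *)
Lemma Lfun2P f : f \in L2 <->
  measurable_fun setT f /\ (\int[mu]_x (f x ^+ 2)%:E < +oo)%E.
Proof.
have E : (\int[mu]_x (f x ^+ 2)%:E = \int[mu]_x (`|f x| `^ 2)%:E)%E.
  by apply: eq_integral => x _; rewrite powR_mulrn// -normrX ger0_norm// sqr_ge0.
rewrite E; split.
  rewrite inE => /andP[/[!inE] mf]; rewrite /finite_norm unlock => fin.
  by split => //; exact: lty_poweRy fin.
move=> [mf fin]; rewrite inE; apply/andP; split; rewrite inE//=.
by rewrite /finite_norm unlock; exact: poweR_lty.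
Qed.

Lemma Lfun2_measurable f : f \in L2 -> measurable_fun setT f.
Proof. by move=> /Lfun2P[]. Qed.

Lemma Lfun2_lin a f g : f \in L2 -> g \in L2 -> a *: f + g \in L2.
Proof. by have [_] := @Lfun_submod_closed _ _ _ mu _ (lee1n 2); apply. Qed.

Lemma Lfun2_0 : (0 : T -> R) \in L2.
Proof. by have [] := @Lfun_submod_closed _ _ _ mu _ (lee1n 2). Qed.

Lemma Lfun2Z a f : f \in L2 -> a *: f \in L2.
Proof. by move=> fL; rewrite -[_ *: _]addr0 Lfun2_lin ?Lfun2_0. Qed.

Lemma Lfun2D f g : f \in L2 -> g \in L2 -> f + g \in L2.
Proof. by move=> fL gL; rewrite -[f]scale1r Lfun2_lin. Qed.

Lemma Lfun2B f g : f \in L2 -> g \in L2 -> f - g \in L2.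
Proof. by move=> fL gL; rewrite addrC -scaleN1r Lfun2_lin. Qed.

Lemma Lfun2_sum (I : Type) (s : seq I) (F : I -> T -> R) :
  (forall i, F i \in L2) -> \sum_(i <- s) F i \in L2.
Proof.
move=> FL; elim: s => [|i s IH]; first by rewrite big_nil Lfun2_0.
by rewrite big_cons Lfun2D.
Qed.

Lemma Lfun2_mul_integrable f g : f \in L2 -> g \in L2 ->
  mu.-integrable setT (EFin \o (fun x => f x * g x)).
Proof. by move=> fL gL; apply/Lfun1_integrable/Lfun2_mul_Lfun1. Qed.

Lemma sqr_L2norm f : f \in L2 -> ((N f ^+ 2)%:E = \int[mu]_x (f x ^+ 2)%:E)%E.
Proof.
move=> fL.
have fin : ('N[mu]_2%:E[EFin \o f] \is a fin_num)%E.
  by rewrite ge0_fin_numE ?Lnorm_ge0//; move: fL; rewrite inE => /andP[_]; rewrite inE.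
rewrite -powR_mulrn ?fine_ge0 ?Lnorm_ge0// /L2norm -poweR_EFin fineK// powR_Lnorm//.
by apply: eq_integral => x _; rewrite /= powR_mulrn// -normrX ger0_norm// sqr_ge0.
Qed.

Lemma L2norm_ge0 f : 0 <= N f.
Proof. by rewrite fine_ge0 ?Lnorm_ge0. Qed.

Lemma L2norm_le_int f g : measurable_fun setT f -> g \in L2 ->
  (\int[mu]_x (f x ^+ 2)%:E <= \int[mu]_x (g x ^+ 2)%:E)%E ->
  f \in L2 /\ N f <= N g.
Proof.
move=> mf gL fg; have fL : f \in L2.
  by apply/Lfun2P; split => //; apply: le_lt_trans fg _; move/Lfun2P : gL => [].
split=> //; rewrite -(@ler_pXn2r _ 2)// ?nnegrE ?L2norm_ge0//.
by rewrite -lee_fin !sqr_L2norm.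
Qed.

Lemma L2normD f g : f \in L2 -> g \in L2 -> N (f + g) <= N f + N g.
Proof.
by move=> fL gL; exact: (ler_LnormD (Lfun_Sub (lee1n 2) fL) (Lfun_Sub (lee1n 2) gL)).
Qed.

Lemma L2normD_le f g x y : f \in L2 -> g \in L2 -> N f <= x -> N g <= y ->
  N (f + g) <= x + y.
Proof. by move=> fL gL fx gy; apply: le_trans (L2normD fL gL) (lerD fx gy). Qed.

Lemma L2normZ a f : f \in L2 -> N (a *: f) = `|a| * N f.
Proof.
move=> fL; apply/eqP; rewrite -(@eqrXn2 _ 2)// ?nnegrE ?mulr_ge0 ?L2norm_ge0//.
apply/eqP/EFin_inj; rewrite sqr_L2norm ?Lfun2Z//.
rewrite exprMn real_normK ?num_real// [RHS]EFinM sqr_L2norm//.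
rewrite -ge0_integralZl_EFin ?sqr_ge0//; first last.
- by apply/measurable_EFinP; apply: measurable_funX; exact: Lfun2_measurable fL.
- by move=> x _; rewrite lee_fin sqr_ge0.
by apply: eq_integral => x _; rewrite -EFinM -exprMn.
Qed.

Lemma L2normN f : N (- f) = N f.
Proof.
congr fine; rewrite -[RHS]oppe_Lnorm; congr Lnorm.
Qed.

Lemma L2norm_distC f g : N (f - g) = N (g - f).
Proof. by rewrite -L2normN opprB. Qed.

Lemma L2norm_dist_triangle f g h : f \in L2 -> g \in L2 -> h \in L2 ->
  N (f - h) <= N (f - g) + N (g - h).
Proof.
by move=> fL gL hL; rewrite -[f - h](subrKA g) L2normD ?Lfun2B.
Qed.

Lemma ae_eq_L2norm f g : f \in L2 -> g \in L2 -> f = g %[ae mu] -> N (f - g) = 0.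
Proof.
move=> fL gL fg; apply/eqP; rewrite -sqrf_eq0 -eqe sqr_L2norm ?Lfun2B//.
apply/eqP; rewrite (@ge0_ae_eq_integral _ _ _ _ _ _ (cst 0%E)) ?integral0//.
- by apply/measurable_EFinP/measurable_funX/Lfun2_measurable/Lfun2B.
- by move=> x _; rewrite lee_fin sqr_ge0.
- apply: filterS fg => x /= /[apply] fgx; rewrite /= fctE fgx subrr expr0n//.
Qed.

End L2_basics.

Ltac in_L2 := by repeat first
  [assumption | apply: Lfun2Z | apply: Lfun2B | apply: Lfun2D | apply: Lfun2_0].

(** * Inner product, orthogonal projection and Bessel inequality *)

Section L2_inner_product.
Context d (T : measurableType d) (R : realType).
Variable mu : {measure set T -> \bar R}.
Implicit Types (f g h : T -> R) (a : R).

Local Notation L2 := (Lfun mu 2%:E).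

Definition L2dot f g : R := \int[mu]_x (f x * g x).

Lemma L2dotC f g : L2dot f g = L2dot g f.
Proof. by apply: eq_Rintegral => x _; rewrite mulrC. Qed.

Lemma L2dot_lin a f g h : f \in L2 -> g \in L2 -> h \in L2 ->
  L2dot (a *: f + g) h = a * L2dot f h + L2dot g h.
Proof.
move=> fL gL hL; rewrite -RintegralZl ?Lfun2_mul_integrable// -RintegralD//.
- by apply: eq_Rintegral => x _; rewrite fctE mulrDl mulrA.
- have -> : EFin \o (fun x => a * (f x * h x)) =
            EFin \o (fun x => (a *: f) x * h x).
    by apply/funext => x /=; rewrite mulrA.
  by rewrite Lfun2_mul_integrable// Lfun2Z.
- exact: Lfun2_mul_integrable.
Qed.

Lemma L2dot0l h : L2dot 0 h = 0.
Proof.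
rewrite /L2dot /Rintegral integral0_eq// => x _.
by rewrite mul0r.
Qed.

Lemma L2dot_suml r (c : 'I_r -> R) (F : 'I_r -> T -> R) h :
  (forall i, F i \in L2) -> h \in L2 ->
  L2dot (\sum_i c i *: F i) h = \sum_i c i * L2dot (F i) h.
Proof.
move=> FL hL; elim: (index_enum _) => [|i s IH].
  by rewrite !big_nil L2dot0l.
rewrite !big_cons L2dot_lin ?IH//.
by apply: Lfun2_sum => j; exact: Lfun2Z.
Qed.

Lemma L2dotD f g h : f \in L2 -> g \in L2 -> h \in L2 ->
  L2dot (f + g) h = L2dot f h + L2dot g h.
Proof. by move=> fL gL hL; rewrite -[f]scale1r L2dot_lin// !scale1r mul1r. Qed.

Lemma L2dotB f g h : f \in L2 -> g \in L2 -> h \in L2 ->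
  L2dot (f - g) h = L2dot f h - L2dot g h.
Proof.
by move=> fL gL hL; rewrite addrC -scaleN1r L2dot_lin// mulN1r addrC.
Qed.

Lemma L2dot_ge0 f : 0 <= L2dot f f.
Proof. by apply: Rintegral_ge0 => x _; rewrite -expr2 sqr_ge0. Qed.

Lemma L2dot_int f : f \in L2 -> ((L2dot f f)%:E = \int[mu]_x (f x ^+ 2)%:E)%E.
Proof.
move=> fL; rewrite /L2dot /Rintegral fineK; last first.
  by apply: integrable_fin_num => //; exact: Lfun2_mul_integrable.
by apply: eq_integral => x _; rewrite expr2.
Qed.

Section bessel.
Variables (r : nat) (V : 'I_r -> T -> R).
Hypothesis VO : L2_orthonormal mu V.
Variables (g : T -> R) (gL : g \in L2).

Let VL i : V i \in L2. Proof. by have [] := VO. Qed.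

Let p := \sum_i L2dot g (V i) *: V i.

Let sumL (w : 'I_r -> R) : \sum_i w i *: V i \in L2.
Proof. by apply: Lfun2_sum => i; exact: Lfun2Z. Qed.

Let dotVV i j : L2dot (V i) (V j) = (i == j)%:R.
Proof. by have [_] := VO; apply. Qed.

Let pL : p \in L2. Proof. exact: sumL. Qed.

Let residual_orth (w : 'I_r -> R) : L2dot (g - p) (\sum_i w i *: V i) = 0.
Proof.
have orth i : L2dot (g - p) (V i) = 0.
  rewrite L2dotB// /p L2dot_suml// (bigD1 i)//= dotVV eqxx mulr1 big1 ?addr0 ?subrr//.
  by move=> j ji; rewrite dotVV (negbTE ji) mulr0.
rewrite L2dotC L2dot_suml ?Lfun2B// big1// => i _.
by rewrite L2dotC orth mulr0.
Qed.

(** Splitting [g - q] as [(g - p) + (p - q)] leaves no cross terms, because [g - p] is orthogonal to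
    the span of [V]. *)
Let pythagoras (w : 'I_r -> R) : let q := \sum_i w i *: V i in
  L2dot (g - q) (g - q) = L2dot (g - p) (g - p) + L2dot (p - q) (p - q).
Proof.
move=> q; have qL : q \in L2 by exact: sumL.
have orth : L2dot (g - p) (p - q) = 0.
  rewrite L2dotC L2dotB ?Lfun2B// L2dotC residual_orth L2dotC residual_orth.
  by rewrite subrr.
have -> : g - q = (g - p) + (p - q) by rewrite subrKA.
move: (g - p) (p - q) (Lfun2B gL pL) (Lfun2B pL qL) orth => u v uL vL uv.
rewrite L2dotD ?Lfun2D// (L2dotC u) (L2dotC v) !L2dotD// uv (L2dotC v) uv.
by rewrite addr0 add0r.
Qed.

(** Pythagoras, with the nonnegative term [L2dot (p - q) (p - q)] dropped. It is phrased with
    integrals of squares so that it can be applied to each section of a function on the product. *)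
Lemma orthonormal_best_approx (w : 'I_r -> R) :
  (\int[mu]_x ((g x - \sum_i L2dot g (V i) * V i x) ^+ 2)%:E <=
   \int[mu]_x ((g x - \sum_i w i * V i x) ^+ 2)%:E)%E.
Proof.
have E (c : 'I_r -> R) : (\int[mu]_x ((g x - \sum_i c i * V i x) ^+ 2)%:E =
    (L2dot (g - \sum_i c i *: V i) (g - \sum_i c i *: V i))%:E)%E.
  rewrite L2dot_int ?Lfun2B//; apply: eq_integral => x _.
  by rewrite fctE fct_sumE.
rewrite !E lee_fin; have /= -> := pythagoras w.
by rewrite lerDl L2dot_ge0.
Qed.

Lemma bessel_inequality :
  (\int[mu]_x ((\sum_i L2dot g (V i) * V i x) ^+ 2)%:E <=
   \int[mu]_x (g x ^+ 2)%:E)%E.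
Proof.
have -> : (\int[mu]_x ((\sum_i L2dot g (V i) * V i x) ^+ 2)%:E =
    (L2dot p p)%:E)%E.
  by rewrite L2dot_int//; apply: eq_integral => x _; rewrite /p fct_sumE.
rewrite -L2dot_int// lee_fin.
(* With all coefficients zero, Pythagoras reads: norm of [g] squared equals residual squared plus
   projection squared. *)
have := pythagoras 0; rewrite /= big1 ?subr0 => [->|i _]; last by rewrite scale0r.
by rewrite lerDr L2dot_ge0.
Qed.

End bessel.
End L2_inner_product.

(** * Projectors on product spaces *)

Section column_projection.
Context d1 d2 (T1 : measurableType d1) (T2 : measurableType d2) (R : realType).
Variable m1 : {sigma_finite_measure set T1 -> \bar R}.
Variable m2 : {sigma_finite_measure set T2 -> \bar R}.
Local Notation om := (m1 \x m2)%E.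
Implicit Types (f g h k u v : (T1 * T2)%type -> R) (a : R).

(** Sections of [u] may fail to be integrable, so Tonelli is applied to the positive and negative
    parts separately; [fine] then preserves measurability of the difference. *)
Lemma measurable_fun_partial_Rintegral u : measurable_fun setT u ->
  measurable_fun setT (fun x => \int[m2]_y u (x, y)).
Proof.
move=> /measurable_EFinP mu.
have E x : (\int[m2]_y (u (x, y))%:E =
    \int[m2]_y (EFin \o u)^\+ (x, y) - \int[m2]_y (EFin \o u)^\- (x, y))%E.
  rewrite integralE; congr (_ - _)%E; apply: eq_integral => y _.
  - by rewrite !funeposE.
  - by rewrite !funenegE.
rewrite /Rintegral; under eq_fun do rewrite E.
apply: measurableT_comp => //; apply: emeasurable_funB.
- by apply: measurable_fun_fubini_tonelli_F => //; exact: measurable_funepos.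
- by apply: measurable_fun_fubini_tonelli_F => //; exact: measurable_funeneg.
Qed.

Lemma ae_Lfun2_section u : u \in Lfun om 2%:E ->
  {ae m1, forall x, (fun y => u (x, y)) \in Lfun m2 2%:E}.
Proof.
move=> uL; have := ae_integrable1 (Lfun2_integrable_sqr uL).
apply: filterS => x /integrableP[_ fin]; apply/Lfun2P; split.
  exact: measurableT_comp (Lfun2_measurable uL) (pair1_measurable x).
by under eq_integral do rewrite -[X in X%:E]ger0_norm ?sqr_ge0//.
Qed.

(** Tonelli for the squares: integrating a bound valid on almost every section gives the bound on
    the product. It reduces the estimates on [projV] to one-variable Hilbert space facts. *)
Lemma L2norm_le_sections u v : measurable_fun setT u -> v \in Lfun om 2%:E ->
  {ae m1, forall x, (\int[m2]_y (u (x, y) ^+ 2)%:E <=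
                     \int[m2]_y (v (x, y) ^+ 2)%:E)%E} ->
  u \in Lfun om 2%:E /\ L2norm om u <= L2norm om v.
Proof.
move=> mu vL uv; apply: L2norm_le_int => //.
have mv := Lfun2_measurable vL.
have msqr (w : (T1 * T2)%type -> R) : measurable_fun setT w ->
    measurable_fun setT (fun z : (T1 * T2)%type => (w z ^+ 2)%:E).
  by move=> mw; apply/measurable_EFinP/measurable_funX.
rewrite !fubini_tonelli1//; try (by move=> z; rewrite lee_fin sqr_ge0);
  try exact: msqr.
have F (w : (T1 * T2)%type -> R) : measurable_fun setT w ->
    measurable_fun setT (fun x => \int[m2]_y (w (x, y) ^+ 2)%:E)%E.
  move=> mw; apply: (measurable_fun_fubini_tonelli_F (fun z => (w z ^+ 2)%:E)).
    exact: msqr.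
  by move=> z; rewrite lee_fin sqr_ge0.
apply: ae_ge0_le_integral => //; try exact: F.
- by move=> x _; apply: integral_ge0 => y _; rewrite lee_fin sqr_ge0.
- by move=> x _; apply: integral_ge0 => y _; rewrite lee_fin sqr_ge0.
- by apply: filterS uv => x.
Qed.

Variables (r : nat) (V : 'I_r -> T2 -> R).
Hypothesis VO : L2_orthonormal m2 V.

Let VL i : V i \in Lfun m2 2%:E. Proof. by have [] := VO. Qed.

Lemma projV_measurable g : measurable_fun setT g ->
  measurable_fun setT (projV m2 V g).
Proof.
move=> mg; apply: measurable_sum => j; apply: measurable_funM; last first.
  exact: measurableT_comp (Lfun2_measurable (VL j)) measurable_snd.
suff mI : measurable_fun setT (fun x => \int[m2]_y (g (x, y) * V j y)).
  exact: measurableT_comp mI measurable_fst.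
apply: (measurable_fun_partial_Rintegral (u := fun z => g z * V j z.2)).
apply: measurable_funM => //.
exact: measurableT_comp (Lfun2_measurable (VL j)) measurable_snd.
Qed.

(** On almost every section all three functions are square integrable, and there the combination is
    the orthogonal projection of [w], so Bessel applies. On the remaining sections the integrals may
    take default values and linearity may fail; treating a combination of three projections at once
    yields norm bound, contraction and almost everywhere linearity from one estimate. *)
Lemma projV_contraction a g h k : g \in Lfun om 2%:E -> h \in Lfun om 2%:E ->
  k \in Lfun om 2%:E ->
  let u := projV m2 V g + a *: projV m2 V h - projV m2 V k in
  u \in Lfun om 2%:E /\ L2norm om u <= L2norm om (g + a *: h - k).
Proof.
move=> gL hL kL u; apply: L2norm_le_sections.
- apply: measurable_funB; last exact: (projV_measurable (Lfun2_measurable kL)).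
  apply: measurable_funD; first exact: (projV_measurable (Lfun2_measurable gL)).
  by apply: measurable_funM => //; exact: (projV_measurable (Lfun2_measurable hL)).
- by rewrite Lfun2B ?Lfun2D ?Lfun2Z.
apply: filterS3 (ae_Lfun2_section gL) (ae_Lfun2_section hL)
  (ae_Lfun2_section kL) => x gx hx kx.
pose w := (fun y => g (x, y)) + a *: (fun y => h (x, y)) - (fun y => k (x, y)).
have wL : w \in Lfun m2 2%:E by rewrite Lfun2B ?Lfun2D ?Lfun2Z.
apply: le_trans (bessel_inequality VO wL).
rewrite le_eqVlt; apply/orP; left; apply/eqP; apply: eq_integral => y _.
congr ((_ ^+ 2)%:E); rewrite /u !fctE /projV /= [a *: _]mulr_sumr -big_split/= -sumrB.
apply: eq_bigr => j _; rewrite /w L2dotB ?Lfun2D ?Lfun2Z//.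
rewrite (addrC (fun y => g (x, y))) L2dot_lin//.
rewrite /L2dot; ring.
Qed.

(** Sectionwise best approximation. The coefficients [w i] are arbitrary functions of the first
    variable, so any square integrable [h] with sections in the span of [V] is a competitor. *)
Lemma projV_best_approx g (w : 'I_r -> T1 -> R) :
  let h := fun z => \sum_i w i z.1 * V i z.2 in
  g \in Lfun om 2%:E -> h \in Lfun om 2%:E ->
  L2norm om (g - projV m2 V g) <= L2norm om (g - h).
Proof.
move=> h gL hL.
suff [] : g - projV m2 V g \in Lfun om 2%:E /\
  L2norm om (g - projV m2 V g) <= L2norm om (g - h) by [].
apply: L2norm_le_sections.
- apply: measurable_funB; first exact: (Lfun2_measurable gL).
  exact: (projV_measurable (Lfun2_measurable gL)).
- exact: Lfun2B.
apply: filterS (ae_Lfun2_section gL) => x gx.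
by have := orthonormal_best_approx VO gx (fun i => w i x).
Qed.

End column_projection.

Lemma Rintegral_lincomb d (T : measurableType d) (R : realType)
    (mu : {measure set T -> \bar R}) (r : nat) (c : 'I_r -> R)
    (F : 'I_r -> T -> R) :
  (forall i, mu.-integrable setT (EFin \o F i)) ->
  \int[mu]_x (\sum_i c i * F i x) = \sum_i c i * \int[mu]_x F i x.
Proof.
move=> iF; have icF i : mu.-integrable setT (fun x => (c i * F i x)%:E).
  exact: integrableZl (iF i).
have E : (\int[mu]_x (\sum_i c i * F i x)%:E =
          \sum_i \int[mu]_x (c i * F i x)%:E)%E.
  by rewrite -integral_sum//; apply: eq_integral => x _; rewrite sumEFin.
rewrite {1}/Rintegral E -sum_fine => [|i _]; last first.
  exact: integrable_fin_num (icF i).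
by apply: eq_bigr => i _; exact: RintegralZl (iF i).
Qed.

(** * Exchanging the two factors *)

Section swap.
Context d1 d2 (T1 : measurableType d1) (T2 : measurableType d2) (R : realType).
Variable m1 : {sigma_finite_measure set T1 -> \bar R}.
Variable m2 : {sigma_finite_measure set T2 -> \bar R}.
Implicit Types u : (T1 * T2)%type -> R.

Lemma Lfun2_swap u : u \in Lfun (m1 \x m2)%E 2%:E ->
  u \o swap \in Lfun (m2 \x m1)%E 2%:E /\
  L2norm (m2 \x m1)%E (u \o swap) = L2norm (m1 \x m2)%E u.
Proof.
move=> uL; have mu := Lfun2_measurable uL.
have mus : measurable_fun setT (u \o @swap T2 T1).
  exact: (measurableT_comp mu (@measurable_swap _ _ T2 T1)).
have E : (\int[m2 \x m1]_z ((u \o swap) z ^+ 2)%:E =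
          \int[m1 \x m2]_z (u z ^+ 2)%:E)%E.
  rewrite fubini_tonelli2 ?fubini_tonelli1//;
    try (by move=> z; rewrite lee_fin sqr_ge0);
    by apply/measurable_EFinP/measurable_funX.
have usL : u \o swap \in Lfun (m2 \x m1)%E 2%:E.
  by apply/Lfun2P; rewrite E; split => //; have /Lfun2P[] := uL.
split=> //; apply/eqP; rewrite -(@eqrXn2 _ 2)// ?nnegrE ?L2norm_ge0//.
by apply/eqP/EFin_inj; rewrite !sqr_L2norm.
Qed.

Variables (r : nat) (X : 'I_r -> T1 -> R).

(** Turns the row projector into a column projector on the exchanged product, so that its estimates
    follow from those of [projV]. *)
Lemma projX_swap u : projX m1 X u = projV m1 X (u \o swap) \o swap.
Proof.
apply/funext => -[x y]; apply: eq_bigr => i _; rewrite mulrC; congr (_ * _).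
by apply: eq_Rintegral => t _; rewrite mulrC.
Qed.

End swap.

(** * Tensor products and iterated integrals *)

Section tensor.
Context d1 d2 (T1 : measurableType d1) (T2 : measurableType d2) (R : realType).
Variable m1 : {sigma_finite_measure set T1 -> \bar R}.
Variable m2 : {sigma_finite_measure set T2 -> \bar R}.
Local Notation om := (m1 \x m2)%E.
Implicit Types (g u : (T1 * T2)%type -> R).

Lemma Lfun2_tensor (p : T1 -> R) (q : T2 -> R) :
  p \in Lfun m1 2%:E -> q \in Lfun m2 2%:E ->
  (fun z => p z.1 * q z.2) \in Lfun om 2%:E.
Proof.
move=> pL qL; have mp := Lfun2_measurable pL; have mq := Lfun2_measurable qL.
have mpq : measurable_fun setT (fun z : (T1 * T2)%type => p z.1 * q z.2).
  apply: measurable_funM.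
    exact: measurableT_comp mp measurable_fst.
  exact: measurableT_comp mq measurable_snd.
apply/Lfun2P; split => //.
rewrite fubini_tonelli1//; last first.
- by move=> z; rewrite lee_fin sqr_ge0.
- exact/measurable_EFinP/measurable_funX.
have E x : (\int[m2]_y ((p x * q y) ^+ 2)%:E =
    (L2norm m2 q ^+ 2)%:E * (p x ^+ 2)%:E)%E.
  rewrite sqr_L2norm// muleC -ge0_integralZl_EFin ?sqr_ge0//.
  - by apply: eq_integral => y _; rewrite exprMn.
  - by move=> y _; rewrite lee_fin sqr_ge0.
  - exact/measurable_EFinP/measurable_funX.
rewrite /fubini_F /=; under eq_integral do rewrite E.
rewrite ge0_integralZl_EFin ?sqr_ge0//.
- by rewrite -sqr_L2norm// -EFinM ltry.
- by move=> y _; rewrite lee_fin sqr_ge0.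
- exact/measurable_EFinP/measurable_funX.
Qed.

Lemma tensor_integrable p q g : p \in Lfun m1 2%:E -> q \in Lfun m2 2%:E ->
  g \in Lfun om 2%:E ->
  om.-integrable setT (EFin \o (fun z => p z.1 * q z.2 * g z)).
Proof. by move=> pL qL gL; apply: Lfun2_mul_integrable => //; exact: Lfun2_tensor. Qed.

(** Fubini for real-valued integrals. The inner integral is finite for almost every [x], where the
    section of [g] is square integrable; there [fine] loses nothing and the integrand agrees with
    [fubini_F]. *)
Lemma iterated_dot p q g : p \in Lfun m1 2%:E -> q \in Lfun m2 2%:E ->
  g \in Lfun om 2%:E ->
  m1.-integrable setT (EFin \o (fun x => p x * \int[m2]_y (g (x, y) * q y))) /\
  \int[m1]_x (p x * \int[m2]_y (g (x, y) * q y)) =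
  \int[om]_z (p z.1 * q z.2 * g z).
Proof.
move=> pL qL gL; have iF := tensor_integrable pL qL gL.
have iK := integrable_fubini_F iF.
set K := fubini_F _ _ in iK.
have mp := Lfun2_measurable pL; have mq := Lfun2_measurable qL.
have mJ : measurable_fun setT (fun x => p x * \int[m2]_y (g (x, y) * q y)).
  apply: measurable_funM => //.
  apply: (measurable_fun_partial_Rintegral m2 (u := fun z => g z * q z.2)).
  apply: measurable_funM; first exact: (Lfun2_measurable gL).
  exact: measurableT_comp mq measurable_snd.
have mK := measurable_int _ iK.
have JK : ae_eq m1 setT (EFin \o (fun x => p x * \int[m2]_y (g (x, y) * q y))) K.
  apply: filterS (ae_Lfun2_section gL) => x gx _.
  rewrite /K /fubini_F /= EFinM /Rintegral fineK; last first.
    by apply: integrable_fin_num => //; exact: Lfun2_mul_integrable.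
  rewrite -integralZl//; last exact: Lfun2_mul_integrable.
  by apply: eq_integral => y _; rewrite -EFinM; congr EFin; ring.
split.
  apply/integrableP; split; first exact/measurable_EFinP.
  have /integrableP[_] := iK; congr (_ < _)%E; apply: ge0_ae_eq_integral => //.
  - exact: measurableT_comp.
  - by apply: measurableT_comp => //; exact/measurable_EFinP.
  - by apply: filterS JK => x H Ix /=; rewrite -(H Ix).
rewrite /Rintegral; congr fine; rewrite -(integral12_prod_meas1 iF).
by apply: ae_eq_integral => //; exact/measurable_EFinP.
Qed.

End tensor.

(** * Row projector and its commutation with the column projector *)

Section row_projection.
Context d1 d2 (T1 : measurableType d1) (T2 : measurableType d2) (R : realType).
Variable m1 : {sigma_finite_measure set T1 -> \bar R}.
Variable m2 : {sigma_finite_measure set T2 -> \bar R}.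
Local Notation om := (m1 \x m2)%E.
Implicit Types (f g h k u v : (T1 * T2)%type -> R) (a : R).

Variables (r : nat) (X : 'I_r -> T1 -> R).
Hypothesis XO : L2_orthonormal m1 X.

Lemma projX_contraction a g h k : g \in Lfun om 2%:E -> h \in Lfun om 2%:E ->
  k \in Lfun om 2%:E ->
  let u := projX m1 X g + a *: projX m1 X h - projX m1 X k in
  u \in Lfun om 2%:E /\ L2norm om u <= L2norm om (g + a *: h - k).
Proof.
move=> gL hL kL u.
have [gsL _] := Lfun2_swap gL; have [hsL _] := Lfun2_swap hL.
have [ksL _] := Lfun2_swap kL.
have [vL vle] := projV_contraction XO a gsL hsL ksL.
have [usL uN] := Lfun2_swap vL.
have <- : L2norm (m2 \x m1)%E ((g + a *: h - k) \o swap) = L2norm om (g + a *: h - k).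
  by apply: (Lfun2_swap _).2; rewrite Lfun2B ?Lfun2D ?Lfun2Z.
by rewrite /u !projX_swap; split => //; rewrite uN.
Qed.

Variables (s : nat) (V : 'I_s -> T2 -> R).
Hypothesis VL : forall j, V j \in Lfun m2 2%:E.

Let XL i : X i \in Lfun m1 2%:E. Proof. by have [] := XO. Qed.

(** Both compositions expand into the double sum of [X i x * V j y * c i j], the coefficient being
    the integral of [g] against a tensor product, evaluated by Fubini in either order. The point
    enters only through [X i x] and [V j y], hence equality holds everywhere. *)
Lemma projV_projX_commute g : g \in Lfun om 2%:E ->
  projV m2 V (projX m1 X g) = projX m1 X (projV m2 V g).
Proof.
move=> gL; have [gsL _] := Lfun2_swap gL.
have swapE i j : \int[(m2 \x m1)%E]_z (V j z.1 * X i z.2 * (g \o swap) z) =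
                 \int[om]_z (X i z.1 * V j z.2 * g z).
  rewrite /Rintegral; congr fine.
  rewrite -(integral21_prod_meas1 (tensor_integrable (VL j) (XL i) gsL)).
  rewrite -(integral12_prod_meas1 (tensor_integrable (XL i) (VL j) gL)).
  apply: eq_integral => x _; apply: eq_integral => y _ /=.
  by rewrite [V j y * _]mulrC.
have dotE i j t : (\int[m1]_s (X i s * g (s, t))) * V j t =
                  V j t * \int[m1]_s ((g \o swap) (t, s) * X i s).
  by rewrite mulrC; congr (_ * _); apply: eq_Rintegral => s' _; rewrite mulrC.
apply/funext => -[x y]; rewrite /projV /projX /=.
pose c i j := \int[om]_z (X i z.1 * V j z.2 * g z).
transitivity (\sum_j \sum_i X i x * V j y * c i j).
  apply: eq_bigr => j _.
  under eq_Rintegral => t _.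
    rewrite mulr_suml; under eq_bigr => i _ do rewrite -mulrA.
    over.
  rewrite /= (Rintegral_lincomb (fun i => X i x)
    (F := fun i t => (\int[m1]_s (X i s * g (s, t))) * V j t)); last first.
    move=> i; have := (iterated_dot (VL j) (XL i) gsL).1.
    by congr (_.-integrable _ _); apply/funext => t /=; rewrite dotE.
  rewrite mulr_suml; apply: eq_bigr => i _; under eq_Rintegral do rewrite dotE.
  rewrite (iterated_dot (VL j) (XL i) gsL).2 swapE -/(c i j).
  by rewrite mulrAC.
rewrite exchange_big; apply: eq_bigr => i _ /=.
under eq_Rintegral => t _.
  rewrite mulr_sumr; under eq_bigr => j _ do rewrite mulrA mulrC.
  over.
rewrite /= (Rintegral_lincomb (fun j => V j y)
  (F := fun j t => X i t * \int[m2]_s (g (t, s) * V j s))); last first.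
  by move=> j; exact: (iterated_dot (XL i) (VL j) gL).1.
rewrite mulr_sumr; apply: eq_bigr => j _.
rewrite (iterated_dot (XL i) (VL j) gL).2 -/(c i j).
by rewrite mulrA.
Qed.

End row_projection.

(** * Low-rank functions *)

(** As a function of [t], the determinant of [Q + t%:M] is the characteristic polynomial of [- Q].
    It has at most [r] roots, so one of the [r + 1] distinct points [e / (k + 1)] is not a root. *)
Lemma small_unit_shift (R : realFieldType) (r : nat) (Q : 'M[R]_r) (e : R) :
  0 < e -> exists t : R, [/\ 0 < t, t <= e & Q + t%:M \in unitmx].
Proof.
move=> e0; pose p := char_poly (- Q).
have detE t : \det (Q + t%:M) = p.[t].
  rewrite /p /char_poly -horner_evalE -det_map_mx; congr (\det _).
  by apply/matrixP => i j; rewrite !mxE /= /horner_eval !hornerE ?hornerMn ?hornerX opprK addrC.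
pose ts := [seq e / k.+1%:R | k <- iota 0 r.+1].
have [allr|/allPn[t]] := boolP (all (root p) ts).
  have : (size ts < size p)%N.
    apply: max_poly_roots => //; first exact/monic_neq0/char_poly_monic.
    rewrite map_inj_uniq ?iota_uniq// => k l /(mulfI (lt0r_neq0 e0)) /invr_inj /eqP.
    by rewrite eqr_nat => /eqP[].
  by rewrite size_map size_iota size_char_poly ltnn.
move=> /mapP[k _ ->] nroot; exists (e / k.+1%:R); split.
- by rewrite divr_gt0.
- by rewrite ler_pdivrMr// -[leLHS]mulr1 ler_pM2l// ler1n.
- by rewrite unitmxE unitfE detE.
Qed.

Section lowrank.
Context d1 d2 (T1 : measurableType d1) (T2 : measurableType d2) (R : realType).
Variable m1 : {sigma_finite_measure set T1 -> \bar R}.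
Variable m2 : {sigma_finite_measure set T2 -> \bar R}.
Local Notation om := (m1 \x m2)%E.

Local Notation tensor p q := (fun z : (T1 * T2)%type => p z.1 * q z.2).

(** The factor [1] puts the outer sum into the shape that [L2dot_suml] expects. *)
Lemma lowrankE r (X : 'I_r -> T1 -> R) (S : 'M[R]_r) (V : 'I_r -> T2 -> R) :
  lowrank X S V = \sum_i 1 *: (\sum_j S i j *: tensor (X i) (V j)).
Proof.
apply/funext => z; rewrite fct_sumE; apply: eq_bigr => i _.
rewrite scale1r fct_sumE; apply: eq_bigr => j _.
by rewrite /= -mulrA.
Qed.

Lemma lowrank_Lfun2 r (X : 'I_r -> T1 -> R) (S : 'M[R]_r) (V : 'I_r -> T2 -> R) :
  (forall i, X i \in Lfun m1 2%:E) -> (forall j, V j \in Lfun m2 2%:E) ->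
  lowrank X S V \in Lfun om 2%:E.
Proof.
move=> XL VL; rewrite lowrankE; apply: Lfun2_sum => i; apply: Lfun2Z.
by apply: Lfun2_sum => j; apply/Lfun2Z/Lfun2_tensor.
Qed.

Lemma L2dot_tensor (p p' : T1 -> R) (q q' : T2 -> R) :
  p \in Lfun m1 2%:E -> p' \in Lfun m1 2%:E ->
  q \in Lfun m2 2%:E -> q' \in Lfun m2 2%:E ->
  L2dot om (tensor p q) (tensor p' q') = L2dot m1 p p' * L2dot m2 q q'.
Proof.
move=> pL p'L qL q'L.
rewrite /L2dot -(iterated_dot pL qL (Lfun2_tensor p'L q'L)).2.
rewrite -RintegralZr ?Lfun2_mul_integrable//; apply: eq_Rintegral => x _.
rewrite -[RHS]mulrA; congr (_ * _); rewrite -RintegralZl ?Lfun2_mul_integrable//.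
by apply: eq_Rintegral => y _; rewrite /=; ring.
Qed.

Lemma L2dot_lowrank_tensor r (X : 'I_r -> T1 -> R) (S : 'M[R]_r)
    (V : 'I_r -> T2 -> R) p q :
  (forall i, X i \in Lfun m1 2%:E) -> (forall j, V j \in Lfun m2 2%:E) ->
  p \in Lfun m1 2%:E -> q \in Lfun m2 2%:E ->
  L2dot om (lowrank X S V) (tensor p q) =
    \sum_i \sum_j L2dot m1 (X i) p * S i j * L2dot m2 (V j) q.
Proof.
move=> XL VL pL qL; have tL := Lfun2_tensor pL qL.
have sL i : \sum_j S i j *: tensor (X i) (V j) \in Lfun om 2%:E.
  by apply: Lfun2_sum => j; apply/Lfun2Z/Lfun2_tensor.
rewrite lowrankE (L2dot_suml (fun=> 1))//; apply: eq_bigr => i _.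
rewrite mul1r (L2dot_suml (S i)); [|by move=> j; exact: Lfun2_tensor|by []].
apply: eq_bigr => j _; rewrite L2dot_tensor//; ring.
Qed.

Lemma ae_eq_L2dot (f g h : (T1 * T2)%type -> R) :
  f \in Lfun om 2%:E -> g \in Lfun om 2%:E -> h \in Lfun om 2%:E ->
  f = g %[ae om] -> L2dot om f h = L2dot om g h.
Proof.
move=> fL gL hL fg; rewrite /L2dot /Rintegral; congr fine.
apply: ae_eq_integral => //.
- exact: measurable_int (Lfun2_mul_integrable fL hL).
- exact: measurable_int (Lfun2_mul_integrable gL hL).
- by apply: filterS fg => z H Iz; rewrite (H Iz).
Qed.

(* Testing against [X a * V b] recovers [S a b], so a factorization with [s]
   terms factors [S] through dimension [s]. *)
Lemma lowrank_rank_manifold r (X : 'I_r -> T1 -> R) (S : 'M[R]_r)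
    (V : 'I_r -> T2 -> R) :
  L2_orthonormal m1 X -> L2_orthonormal m2 V -> S \in unitmx ->
  rank_manifold m1 m2 r (lowrank X S V).
Proof.
move=> [XL XO] [VL VO] Su; have fL := lowrank_Lfun2 S XL VL.
split=> //.
  by exists X, S, V; split => //; exact: ae_eq_refl.
move=> s sr [X' [S' [V' [X'L V'L E]]]].
have f'L := lowrank_Lfun2 S' X'L V'L.
pose P : 'M[R]_(r, s) := \matrix_(a, i) L2dot m1 (X' i) (X a).
pose Q : 'M[R]_(s, r) := \matrix_(j, b) L2dot m2 (V' j) (V b).
have SE : S = P *m (S' *m Q).
  apply/matrixP => a b.
  have := ae_eq_L2dot fL f'L (Lfun2_tensor (XL a) (VL b)) E.
  rewrite !L2dot_lowrank_tensor//.
  rewrite (bigD1 a)//= (bigD1 b)//= [X in _ + X + _]big1; last first.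
    by move=> j jb; rewrite [L2dot m2 _ _]VO (negbTE jb) mulr0.
  rewrite [X in _ + X]big1; last first.
    move=> i ia; rewrite big1// => j _.
    by rewrite [L2dot m1 _ _]XO (negbTE ia) !mul0r.
  rewrite [L2dot m1 (X a) _]XO [L2dot m2 (V b) _]VO !eqxx mul1r mulr1 !addr0.
  move=> ->; rewrite mxE; apply: eq_bigr => i _.
  rewrite !mxE mulr_sumr; apply: eq_bigr => j _.
  by rewrite !mxE mulrA.
move: Su; rewrite -row_free_unit /row_free SE => /eqP rk.
have := mxrankM_maxl P (S' *m Q); rewrite rk => rP.
by have := leq_trans rP (rank_leq_col P); rewrite leqNgt sr.
Qed.

End lowrank.

(** * Euler estimates for differential equations in [L^2] *)

Section L2_mean_value.
Context d (T : measurableType d) (R : realType).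
Variable mu : {measure set T -> \bar R}.
Local Notation L2 := (Lfun mu 2%:E).
Local Notation N := (L2norm mu).

Variables (F : (T -> R) -> (T -> R)) (a b : R) (u0 : T -> R) (u : R -> T -> R).
Hypothesis ode : L2_ode_solution mu F a b u0 u.
Variables (c : T -> R) (M : R).
Hypothesis cL : c \in L2.
Hypothesis FL : forall t, a <= t <= b -> F (u t) \in L2.
Hypothesis Fc : forall t, a <= t <= b -> N (F (u t) - c) <= M.

Let uL t : a <= t <= b -> u t \in L2.
Proof. by move=> tab; have [+ _ _] := ode; apply; rewrite in_itv. Qed.

(** Differentiability at [t] replaces the difference quotient by [F (u t)] up to [e], and [F (u t)]
    is within [M] of [c]. *)
Let increment_near (e t : R) : 0 < e -> a <= t <= b ->
  exists2 del : R, 0 < del & forall s, a <= s <= b -> `|t - s| < del ->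
    N (u s - u t - (s - t) *: c) <= (M + e) * `|s - t|.
Proof.
move=> e0 tab; have [_ _ /(_ t)] := ode; rewrite in_itv /= => /(_ tab).
move=> /cvgrPdist_lt /(_ e e0); rewrite near_withinE near_withinE.
move=> /nbhs_ballP[del /= del0 H]; exists del => // s sab ts.
(* The limit concerns the punctured neighbourhood, so [s = t] is treated apart. *)
have [->|st] := eqVneq s t.
  by rewrite !subrr scale0r subr0 normr0 mulr0 -(scale0r c) L2normZ// normr0 mul0r.
have := H s ts st; rewrite /= in_itv /= => /(_ sab).
rewrite sub0r normrN ger0_norm ?L2norm_ge0// => lte.
have suL := uL sab; have tuL := uL tab; have FuL := FL tab.
have st0 : s - t != 0 by rewrite subr_eq0.
have -> : u s - u t - (s - t) *: c =
    (s - t) *: ((s - t)^-1 *: (u s - u t) - c).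
  by rewrite scalerBr scalerA divff// scale1r.
rewrite L2normZ ?Lfun2B ?Lfun2Z ?Lfun2B// mulrC ler_wpM2r//.
apply: le_trans (@L2norm_dist_triangle _ _ _ mu _ (F (u t)) _ _ _ _) _ => //.
  by rewrite Lfun2Z ?Lfun2B.
by rewrite [leRHS]addrC lerD ?Fc// ltW.
Qed.

(** Mean value inequality by continuous induction, which avoids integrating functions with values in
    the space: the bound with slope [M + e] propagates from [a] to [t], then the slack is sent to
    zero. *)
Lemma L2_mean_value t : a <= t <= b ->
  N (u t - u a - (t - a) *: c) <= M * (t - a).
Proof.
move=> /andP[at_ tb]; apply/ler_addgt0Pr => e0 e0_gt0.
have [->|at1] := eqVneq a t.
  rewrite !subrr mulr0 scale0r subr0 -(scale0r c) L2normZ// normr0 mul0r.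
  by rewrite add0r ltW.
have lt_at : 0 < t - a by rewrite subr_gt0 lt_neqAle at1.
(* Scaled so that the slack accumulated over the whole interval is exactly [e0]. *)
pose e := e0 / (t - a).
have e_gt0 : 0 < e by rewrite divr_gt0.
have -> : M * (t - a) + e0 = (M + e) * (t - a).
  by rewrite mulrDl /e divfK// gt_eqF.
pose A := [set s | a <= s <= t /\ N (u s - u a - (s - a) *: c) <= (M + e) * (s - a)].
have ab s : a <= s <= t -> a <= s <= b.
  by move=> /andP[-> st]; exact: le_trans tb.
have uaL : u a \in L2 by apply: uL; rewrite lexx (le_trans at_).
have Aa : A a.
  split; first by rewrite lexx.
  by rewrite !subrr mulr0 scale0r subr0 -(scale0r c) L2normZ// normr0 mul0r.
have supA : has_sup A.
  by split; [exists a|exists t => s [/andP[]]].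
(* Bounds on adjacent intervals add up, since the linear terms do. *)
have step s s' : a <= s -> s <= s' -> s' <= t ->
    N (u s - u a - (s - a) *: c) <= (M + e) * (s - a) ->
    N (u s' - u s - (s' - s) *: c) <= (M + e) * (s' - s) -> A s'.
  move=> as_ ss' s't H1 H2; have as' := le_trans as_ ss'.
  split; first by rewrite as'.
  have sL : u s \in L2 by apply/uL/ab; rewrite as_ (le_trans ss').
  have s'L : u s' \in L2 by apply/uL/ab; rewrite as'.
  have -> : u s' - u a - (s' - a) *: c =
      (u s' - u s - (s' - s) *: c) + (u s - u a - (s - a) *: c).
    by rewrite !scalerBl; apply/funext => x; rewrite !fctE; ring.
  apply: le_trans (L2normD _ _) _; rewrite ?Lfun2B ?Lfun2Z//.
  apply: le_trans (lerD H2 H1) _.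
  by rewrite -mulrDr subrKA.
have as_ : a <= sup A by apply: ub_le_sup => //; exact: supA.2.
have st : sup A <= t by apply: ge_sup; [exists a|move=> s [/andP[]]].
have sab : a <= sup A <= b by apply: ab; rewrite as_.
have [del del0 near_s] := increment_near e_gt0 sab.
(* A point of [A] less than [del] below the supremum carries the bound up to the supremum itself. *)
have As : A (sup A).
  have [s0 [/andP[as0 s0t] Hs0] s0s] := sup_adherent del0 supA.
  have s0_le : s0 <= sup A.
    by apply: ub_le_sup; [exact: supA.2|split => //; rewrite as0].
  have s0ab : a <= s0 <= b by apply: ab; rewrite as0.
  apply: (step s0) => //.
  have := near_s s0 s0ab; rewrite ger0_norm ?subr_ge0// => /(_ _).
  rewrite distrC ger0_norm ?subr_ge0//.
  have -> : u s0 - u (sup A) - (s0 - sup A) *: c =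
      - (u (sup A) - u s0 - (sup A - s0) *: c).
    by rewrite !scalerBl; apply/funext => x; rewrite !fctE; ring.
  by rewrite L2normN; apply; rewrite ltrBlDl addrC -ltrBlDl.
have [tE|s_neq_t] := eqVneq (sup A) t.
  by case: As => _; rewrite tE.
have slt : sup A < t by rewrite lt_neqAle s_neq_t.
(* If the supremum were below [t], the bound would extend past it by [del / 2] or up to [t], a
   contradiction. *)
pose s' := Num.min t (sup A + del / 2).
have ss' : sup A < s' by rewrite lt_min slt ltrDl divr_gt0.
have s't : s' <= t by rewrite ge_min lexx.
have s'ab : a <= s' <= b by apply: ab; rewrite s't (le_trans as_ (ltW ss')).
have As' : A s'.
  apply: (step (sup A)) => //; [exact: ltW|by case: As|].
  have s's0 : 0 <= s' - sup A by rewrite subr_ge0 ltW.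
  have := near_s s' s'ab; rewrite distrC (ger0_norm s's0); apply.
  rewrite ltrBlDl; apply: le_lt_trans (_ : sup A + del / 2 < _).
    by rewrite ge_min lexx orbT.
  by rewrite ltrD2l gtr_pMr// invf_lt1 ?ltr1n.
by have := ub_le_sup supA.2 As'; rewrite leNgt ss'.
Qed.

End L2_mean_value.

Section euler.
Context d (T : measurableType d) (R : realType).
Variable mu : {measure set T -> \bar R}.
Local Notation L2 := (Lfun mu 2%:E).
Local Notation N := (L2norm mu).

(** Lets the exact solution be restarted at each grid point, with its own value there as initial
    value. *)
Lemma L2_ode_solution_sub (F : (T -> R) -> (T -> R)) (a b a' b' : R)
    (u0 : T -> R) (u : R -> T -> R) :
  a <= a' -> b' <= b ->
  L2_ode_solution mu F a b u0 u -> L2_ode_solution mu F a' b' (u a') u.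
Proof.
move=> aa' b'b [uL _ du].
have sub t : t \in `[a', b'] -> t \in `[a, b].
  rewrite !in_itv /= => /andP[a't tb'].
  by rewrite (le_trans aa' a't) (le_trans tb' b'b).
split=> [t /sub/uL//||t tab]; first exact: ae_eq_refl.
have cvg_t := du t (sub t tab).
apply: cvg_trans; last exact: cvg_t.
move=> D; rewrite !nbhs_simpl /= /within /= => H.
apply: filterS H => s Ds /sub; exact: Ds.
Qed.

(** A Lipschitz constant can be negative if all distances vanish; raising it to zero makes it usable
    as a factor in inequalities. *)
Lemma L2_bounded_lipschitz_max (F : (T -> R) -> (T -> R)) (B C : R) :
  L2_bounded_lipschitz mu F B C -> L2_bounded_lipschitz mu F B (Num.max C 0).
Proof.
move=> [FL FB FC]; split => // f g fL gL; apply: le_trans (FC f g fL gL) _.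
by rewrite ler_wpM2r ?L2norm_ge0// le_max lexx.
Qed.

Variables (F : (T -> R) -> (T -> R)) (B C : R).
Hypothesis C0 : 0 <= C.
Hypothesis FBC : L2_bounded_lipschitz mu F B C.

Let FL f : f \in L2 -> F f \in L2. Proof. by have [+ _ _] := FBC; apply. Qed.

Lemma L2_bounded_lipschitz_ge0 : 0 <= B.
Proof.
by have [_ FB _] := FBC; rewrite (le_trans _ (FB 0 _)) ?L2norm_ge0 ?Lfun2_0.
Qed.

(** [F] acts on representatives; the Lipschitz bound makes it compatible with almost everywhere
    equality. *)
Lemma ae_eq_lipschitz f g : f \in L2 -> g \in L2 -> f = g %[ae mu] ->
  N (F f - F g) = 0.
Proof.
move=> fL gL fg; have [_ _ /(_ f g fL gL)] := FBC.
rewrite (ae_eq_L2norm fL gL fg) mulr0 => le0.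
by apply/eqP; rewrite eq_le le0 L2norm_ge0.
Qed.

Variables (a b : R) (u0 : T -> R) (u : R -> T -> R).
Hypothesis ode : L2_ode_solution mu F a b u0 u.
Hypothesis u0L : u0 \in L2.

Let uL t : a <= t <= b -> u t \in L2.
Proof. by move=> tab; have [+ _ _] := ode; apply; rewrite in_itv. Qed.

Let increment_le t : a <= t <= b -> N (u t - u a) <= B * (t - a).
Proof.
move=> tab; have [_ FB _] := FBC.
have FuL s : a <= s <= b -> F (u s) \in L2 by move=> /uL; exact: FL.
have FuB s : a <= s <= b -> N (F (u s) - 0) <= B.
  by move=> /uL; rewrite subr0; exact: FB.
by have := L2_mean_value ode (Lfun2_0 mu) FuL FuB tab; rewrite scaler0 subr0.
Qed.

(** The solution moves by at most [B * (b - a)], so its velocity changes by at most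
    [C * B * (b - a)], which gives the quadratic defect. [v] is any representative of the final
    value. *)
Lemma euler_step v : a <= b -> v \in L2 -> u b = v %[ae mu] ->
  N (v - u0) <= B * (b - a) /\
  N (v - u0 - (b - a) *: F u0) <= C * B * (b - a) ^+ 2.
Proof.
move=> ab vL ubv; have [_ uau0 _] := ode; have [_ FB FC] := FBC.
have aab : a <= a <= b by rewrite lexx.
have bab : a <= b <= b by rewrite lexx ab.
have uaL := uL aab; have ubL := uL bab.
have v0 := ae_eq_L2norm ubL vL ubv; have a0 := ae_eq_L2norm uaL u0L uau0.
have F0 := ae_eq_lipschitz uaL u0L uau0.
have FuaL := FL uaL; have Fu0L := FL u0L.
have va : N (v - u b) <= 0 by rewrite L2norm_distC v0.
split.
  have -> : v - u0 = (v - u b) + ((u b - u a) + (u a - u0)).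
    by rewrite !subrKA.
  have -> : B * (b - a) = 0 + (B * (b - a) + 0) by ring.
  apply: L2normD_le; [in_L2|in_L2|by []|].
  by apply: L2normD_le; [in_L2|in_L2|exact: increment_le|rewrite a0].
(* Mean value inequality with the initial velocity [F (u a)] as the constant [c]. *)
have main : N (u b - u a - (b - a) *: F (u a)) <= C * B * (b - a) * (b - a).
  apply: (L2_mean_value ode FuaL) => // t tab; first exact/FL/uL.
  apply: le_trans (FC _ _ (uL tab) uaL) _; rewrite -mulrA ler_wpM2l//.
  apply: le_trans (increment_le tab) _.
  by rewrite ler_wpM2l ?L2_bounded_lipschitz_ge0// lerB//; case/andP: tab.
(* Besides the main term, only changes of representative occur, all of norm zero. *)
have -> : v - u0 - (b - a) *: F u0 = (v - u b) +
    ((u b - u a - (b - a) *: F (u a)) +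
     ((u a - u0) + (b - a) *: (F (u a) - F u0))).
  rewrite scalerBr; apply/funext => x; rewrite !fctE; ring.
have -> : C * B * (b - a) ^+ 2 = 0 + (C * B * (b - a) * (b - a) + (0 + 0)) by ring.
apply: L2normD_le; [in_L2|in_L2|by []|].
apply: L2normD_le; [in_L2|in_L2|by []|].
apply: L2normD_le; [in_L2|in_L2|by rewrite a0|].
by rewrite L2normZ ?F0 ?mulr0//; in_L2.
Qed.

End euler.

(** * Norm bounds for the projectors and the projected vector fields *)

Section projection_corollaries.
Context d1 d2 (T1 : measurableType d1) (T2 : measurableType d2) (R : realType).
Variable m1 : {sigma_finite_measure set T1 -> \bar R}.
Variable m2 : {sigma_finite_measure set T2 -> \bar R}.
Local Notation om := (m1 \x m2)%E.
Local Notation L2 := (Lfun om 2%:E).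
Local Notation N := (L2norm om).
Implicit Types (f g h k : (T1 * T2)%type -> R).
Variables (r : nat) (X : 'I_r -> T1 -> R) (V : 'I_r -> T2 -> R).
Hypothesis XO : L2_orthonormal m1 X.
Hypothesis VO : L2_orthonormal m2 V.

Lemma projX0 : projX m1 X (0 : (T1 * T2)%type -> R) = 0.
Proof.
apply/funext => z; rewrite /projX big1// => i _.
by rewrite /Rintegral integral0_eq ?mulr0// => x _; rewrite mulr0.
Qed.

Lemma projV0 : projV m2 V (0 : (T1 * T2)%type -> R) = 0.
Proof.
apply/funext => z; rewrite /projV big1// => i _.
by rewrite /Rintegral integral0_eq ?mul0r// => x _; rewrite mul0r.
Qed.

Lemma projX_norm_le g : g \in L2 -> projX m1 X g \in L2 /\ N (projX m1 X g) <= N g.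
Proof.
move=> gL; have := projX_contraction XO 0 gL (Lfun2_0 om) (Lfun2_0 om).
by rewrite /= projX0 !scaler0 !addr0 !subr0.
Qed.

Lemma projV_norm_le g : g \in L2 -> projV m2 V g \in L2 /\ N (projV m2 V g) <= N g.
Proof.
move=> gL; have := projV_contraction VO 0 gL (Lfun2_0 om) (Lfun2_0 om).
by rewrite /= projV0 !scaler0 !addr0 !subr0.
Qed.

Lemma projX_dist_le g h : g \in L2 -> h \in L2 ->
  N (projX m1 X g - projX m1 X h) <= N (g - h).
Proof.
move=> gL hL; have [_] := projX_contraction XO 0 gL (Lfun2_0 om) hL.
by rewrite !scale0r !addr0.
Qed.

Lemma projV_dist_le g h : g \in L2 -> h \in L2 ->
  N (projV m2 V g - projV m2 V h) <= N (g - h).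
Proof.
move=> gL hL; have [_] := projV_contraction VO 0 gL (Lfun2_0 om) hL.
by rewrite !scale0r !addr0.
Qed.

(** The contraction estimate with [k := g + a *: h], whose right-hand side is zero. *)
Lemma projV_lin_ae (a : R) g h : g \in L2 -> h \in L2 ->
  N (projV m2 V g + a *: projV m2 V h - projV m2 V (g + a *: h)) = 0.
Proof.
move=> gL hL; have ghL : g + a *: h \in L2 by rewrite Lfun2D ?Lfun2Z.
have [_] := projV_contraction VO a gL hL ghL.
rewrite subrr => le0; apply/eqP; rewrite eq_le L2norm_ge0 andbT.
apply: le_trans le0 _.
by rewrite -(scale0r g) L2normZ// normr0 mul0r.
Qed.

Variables (L : ((T1 * T2)%type -> R) -> ((T1 * T2)%type -> R)) (B C : R).
Hypothesis LBC : L2_bounded_lipschitz om L B C.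

(** Projecting keeps both constants, so the Euler estimate applies to the sub-problems with the same
    [B] and [C]. *)
Lemma projX_bounded_lipschitz :
  L2_bounded_lipschitz om (fun g => projX m1 X (L g)) B C.
Proof.
have [LL LB LC] := LBC; split.
- by move=> f fL; have [] := projX_norm_le (LL _ fL).
- move=> f fL; apply: le_trans (LB f fL).
  by have [] := projX_norm_le (LL _ fL).
- move=> f g fL gL; apply: le_trans (LC f g fL gL).
  exact: projX_dist_le (LL _ fL) (LL _ gL).
Qed.

Lemma projV_bounded_lipschitz :
  L2_bounded_lipschitz om (fun g => projV m2 V (L g)) B C.
Proof.
have [LL LB LC] := LBC; split.
- by move=> f fL; have [] := projV_norm_le (LL _ fL).
- move=> f fL; apply: le_trans (LB f fL).
  by have [] := projV_norm_le (LL _ fL).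
- move=> f g fL gL; apply: le_trans (LC f g fL gL).
  exact: projV_dist_le (LL _ fL) (LL _ gL).
Qed.

End projection_corollaries.

Lemma ae_snd d1 d2 (T1 : measurableType d1) (T2 : measurableType d2)
    (R : realType) (m1 : {sigma_finite_measure set T1 -> \bar R})
    (m2 : {sigma_finite_measure set T2 -> \bar R}) (P : T2 -> Prop) :
  {ae m2, forall y, P y} -> {ae (m1 \x m2)%E, forall z, P z.2}.
Proof.
move=> [A [mA A0 PA]]; exists (setT `*` A); split.
- exact: measurableX.
- by rewrite product_measure1E// A0 mule0.
- by move=> z /= nP; split => //; exact: PA.
Qed.

(** * The GAP step *)

Section gap_step_euler.
Context d1 d2 (T1 : measurableType d1) (T2 : measurableType d2) (R : realType).
Variable m1 : {sigma_finite_measure set T1 -> \bar R}.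
Variable m2 : {sigma_finite_measure set T2 -> \bar R}.
Local Notation om := (m1 \x m2)%E.
Local Notation L2 := (Lfun om 2%:E).
Local Notation N := (L2norm om).
Variables (r : nat) (L : ((T1 * T2)%type -> R) -> ((T1 * T2)%type -> R)).
Variables (B C eta : R).
Hypothesis C0 : 0 <= C.
Hypothesis LBC : L2_bounded_lipschitz om L B C.
Hypothesis Leta : tangent_residual_le m1 m2 r L eta.

Let LL g : g \in L2 -> L g \in L2. Proof. by have [+ _ _] := LBC; apply. Qed.

Section completed_tangent_space.
Variables (X : 'I_r -> T1 -> R) (V : 'I_r -> T2 -> R).
Hypotheses (XO : L2_orthonormal m1 X) (VO : L2_orthonormal m2 V).
Let XL i : X i \in Lfun m1 2%:E. Proof. by have [] := XO. Qed.
Let VL i : V i \in Lfun m2 2%:E. Proof. by have [] := VO. Qed.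

(* The core [Q] may be singular; perturbing it to an invertible matrix puts the
   approximation on the manifold, where the tangent residual is controlled. *)
Lemma full_rank_perturbation (Q : 'M[R]_r) (e : R) : 0 < e ->
  exists S : 'M[R]_r,
    S \in unitmx /\ N (lowrank X Q V - lowrank X S V) <= e.
Proof.
move=> e0; pose n1 := N (lowrank X 1%:M V) + 1.
have n10 : 0 < n1 by rewrite ltr_wpDl ?L2norm_ge0.
have [t [t0 te tu]] := small_unit_shift Q (divr_gt0 e0 n10).
exists (Q + t%:M); split=> //.
have -> : lowrank X Q V - lowrank X (Q + t%:M) V = (- t) *: lowrank X 1%:M V.
  apply/funext => z; rewrite !fctE /lowrank [RHS]mulr_sumr -sumrB.
  apply: eq_bigr => i _; rewrite mulr_sumr -sumrB; apply: eq_bigr => j _.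
  by rewrite !mxE -mulr_natr -[1 *+ _]/((_)%:R); ring.
rewrite L2normZ ?lowrank_Lfun2// normrN gtr0_norm//.
apply: le_trans (_ : t * n1 <= _); first by rewrite ler_wpM2l ?(ltW t0)// lerDl.
by rewrite -ler_pdivlMr.
Qed.

Lemma lowrank_columnsE (Q : 'M[R]_r) :
  lowrank X Q V =
  (fun z => \sum_j (\sum_i Q i j * X i z.1) * V j z.2) :> (T1 * T2 -> R).
Proof.
apply/funext => z; rewrite /lowrank exchange_big; apply: eq_bigr => j _.
by rewrite mulr_suml.
Qed.

(** Displays the competitor used in the step estimate as a combination of the [V j] with
    coefficients in the first variable, as [projV_best_approx] requires. *)
Lemma projV_lowrankD (Q : 'M[R]_r) (a : R) (g h : (T1 * T2)%type -> R) :
  lowrank X Q V + a *: (projV m2 V g - projV m2 V h) =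
  (fun z => \sum_j (\sum_i Q i j * X i z.1 +
     a * (\int[m2]_t (g (z.1, t) * V j t) -
          \int[m2]_t (h (z.1, t) * V j t))) * V j z.2).
Proof.
apply/funext => z; rewrite lowrank_columnsE !fctE /projV -sumrB.
by rewrite [a *: _]mulr_sumr -big_split; apply: eq_bigr => j _ /=; ring.
Qed.

End completed_tangent_space.

Lemma gap_step_euler (a b : R) (X0 : 'I_r -> T1 -> R) (S0 : 'M[R]_r)
    (V0 : 'I_r -> T2 -> R) (X1 : 'I_r -> T1 -> R) (S1 : 'M[R]_r)
    (V1 : 'I_r -> T2 -> R) :
  a < b -> L2_orthonormal m1 X0 -> L2_orthonormal m2 V0 ->
  gap_step m1 m2 L a b X0 S0 V0 X1 S1 V1 ->
  N (lowrank X1 S1 V1 - lowrank X0 S0 V0 - (b - a) *: L (lowrank X0 S0 V0)) <=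
    C * (5 * B + 2) * (b - a) ^+ 2 + (b - a) * eta.
Proof.
move=> ab X0O V0O [l [k [W [[lode WL lb [V1O [Q WQ]]] kode X1O kb]]]].
set y := lowrank X0 S0 V0.
have [X0L _] := X0O; have [V0L _] := V0O; have [X1L _] := X1O.
have [V1L _] := V1O.
set dt := b - a; have dt0 : 0 < dt by rewrite subr_gt0.
have yL : y \in L2 by exact: lowrank_Lfun2.
have y1L : lowrank X1 S1 V1 \in L2 by exact: lowrank_Lfun2.
set y1 := lowrank X1 S1 V1 in y1L *.
pose h := lowrank X0 Q V1.
have hL : h \in L2 by exact: lowrank_Lfun2.
(* The orthonormalization [W = V1 Q] puts the end point of the first sub-problem into the range of
   the projector onto [V1]. *)
have lh : l b = h %[ae om].
  have Wae : {ae m2, forall y', forall i : 'I_r,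
      W i y' = \sum_j Q i j * V1 j y'}.
    by apply: filter_forall => i; apply: filterS (WQ i) => y' /(_ I).
  apply: filterS2 lb (ae_snd m1 Wae) => z lz Wz /lz ->.
  apply: eq_bigr => i _; rewrite Wz mulr_sumr; apply: eq_bigr => j _.
  ring.
have [hy hEuler] := euler_step C0 (projX_bounded_lipschitz X0O LBC) lode yL
  (ltW ab) hL lh.
have [pL _] := projV_norm_le V1O yL.
set p := projV m2 V1 y in pL.
have [_ kEuler] := euler_step C0 (projV_bounded_lipschitz V1O LBC) kode pL
  (ltW ab) y1L kb.
rewrite -/dt in hy hEuler kEuler.
have [S [Su hS]] := full_rank_perturbation X0O V1O Q dt0.
pose z := lowrank X0 S V1.
have zL : z \in L2 by exact: lowrank_Lfun2.
have zres : N (L z - tangent_proj m1 m2 X0 V1 (L z)) <= eta.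
  apply: (Leta (S := S)) => //; last exact: ae_eq_refl.
  exact: lowrank_rank_manifold.
have [[LyL LzL] LpL] := (LL yL, LL zL, LL pL).
have [pxzL _] := projX_norm_le X0O LzL.
have [pxyL _] := projX_norm_le X0O LyL.
have [pvzL _] := projV_norm_le V1O LzL.
have [pvyL _] := projV_norm_le V1O LyL.
have [pvpL _] := projV_norm_le V1O LpL.
have [pvxzL _] := projV_norm_le V1O pxzL.
pose g := y + dt *: L y.
have gL : g \in L2 by rewrite /g; in_L2.
have [pgL _] := projV_norm_le V1O gL.
(* Competitor in the range of the projector onto [V1]: with it, [g - h'] contains exactly [dt] times
   the normal part of [L z]. Minimality of the projection then replaces computing with the
   complementary projector. *)
pose h' := h + dt *: (projV m2 V1 (L z) - projV m2 V1 (projX m1 X0 (L z))).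
have h'L : h' \in L2 by rewrite /h'; in_L2.
have gmin : N (g - projV m2 V1 g) <= N (g - h').
  move: h'L; rewrite /h' /h projV_lowrankD => h'L.
  exact: (projV_best_approx V1O (w := fun j x => \sum_i Q i j * X0 i x +
     dt * (\int[m2]_t (L z (x, t) * V1 j t) -
           \int[m2]_t (projX m1 X0 (L z) (x, t) * V1 j t)))).
have [_ _ Llip] := LBC.
have yzN : N (y - z) <= (B + 1) * dt.
  rewrite mulrDl mul1r; apply: le_trans (L2norm_dist_triangle yL hL zL) _.
  by rewrite lerD// L2norm_distC.
have LyzN : N (L y - L z) <= C * ((B + 1) * dt).
  by apply: le_trans (Llip _ _ yL zL) _; rewrite ler_wpM2l.
(* Projecting the input onto the new basis costs only [B * dt], because [h] lies in the range and is
   that close to [y]. *)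
have ypN : N (p - y) <= B * dt.
  rewrite L2norm_distC; apply: le_trans (_ : N (y - h) <= _).
    move: hL; rewrite /h lowrank_columnsE => hL.
    exact: (projV_best_approx V1O (w := fun j x => \sum_i Q i j * X0 i x)).
  by rewrite L2norm_distC.
have PLpyN : N (projV m2 V1 (L p) - projV m2 V1 (L y)) <= C * (B * dt).
  apply: le_trans (projV_dist_le V1O LpL LyL) _.
  by apply: le_trans (Llip _ _ pL yL) _; rewrite ler_wpM2l.
have tanL : tangent_proj m1 m2 X0 V1 (L z) \in L2.
  by rewrite /tangent_proj -projV_projX_commute//; in_L2.
have gh'N : N (g - h') <= C * B * dt ^+ 2 + (dt * eta +
    (dt * (C * ((B + 1) * dt)) + dt * (C * ((B + 1) * dt)))).
  (* First Euler defect, normal part at [z], and two corrections for passing between [L y] and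
     [L z]; the commutation of the projectors identifies the normal part. *)
  have -> : g - h' = - (h - y - dt *: projX m1 X0 (L y)) +
      (dt *: (L z - tangent_proj m1 m2 X0 V1 (L z)) +
       (dt *: (L y - L z) +
        dt *: (projX m1 X0 (L z) - projX m1 X0 (L y)))).
    rewrite /g /h' /tangent_proj projV_projX_commute//.
    rewrite !(scalerBr, scalerDr); apply/funext => x; rewrite !fctE; ring.
  apply: L2normD_le; [by rewrite -scaleN1r; in_L2|in_L2|by rewrite L2normN|].
  apply: L2normD_le; [in_L2|in_L2| |].
    by rewrite L2normZ ?gtr0_norm ?ler_pM2l//; in_L2.
  apply: L2normD_le; [in_L2|in_L2| |].
    by rewrite L2normZ ?gtr0_norm ?ler_pM2l//; in_L2.
  rewrite L2normZ ?gtr0_norm ?ler_pM2l//; last by in_L2.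
  by apply: le_trans (projX_dist_le X0O LzL LyL) _; rewrite L2norm_distC.
(* Second Euler defect, change of argument from [p] to [y], a null linearity defect, and the
   residual [g - projV m2 V1 g]. *)
have -> : y1 - y - dt *: L y = (y1 - p - dt *: projV m2 V1 (L p)) +
    (dt *: (projV m2 V1 (L p) - projV m2 V1 (L y)) +
     ((p + dt *: projV m2 V1 (L y) - projV m2 V1 g) -
      (g - projV m2 V1 g))).
  by rewrite {2}/g scalerBr; apply/funext => x; rewrite !fctE; ring.
(* The two Euler defects and the change from [p] to [y] contribute [B] each, the two corrections
   [B + 1] each. *)
have -> : C * (5 * B + 2) * dt ^+ 2 + dt * eta =
    C * B * dt ^+ 2 + (dt * (C * (B * dt)) + (0 + (C * B * dt ^+ 2 + (dt * eta +
    (dt * (C * ((B + 1) * dt)) + dt * (C * ((B + 1) * dt))))))) by ring.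
apply: L2normD_le; [in_L2|in_L2|by []|].
apply: L2normD_le; [in_L2|in_L2| |].
  by rewrite L2normZ ?gtr0_norm ?ler_pM2l//; in_L2.
apply: L2normD_le; [in_L2|by rewrite -scaleN1r; in_L2|by rewrite projV_lin_ae|].
by rewrite L2normN; exact: le_trans gmin gh'N.
Qed.

End gap_step_euler.

(** * Discrete Gronwall inequality and global error *)

(** Each of the [N] source terms is amplified by at most the full power [(1 + c) ^+ N]; bounding the
    geometric sum this way avoids dividing by [c]. *)
Lemma discrete_gronwall (R : realFieldType) (e : nat -> R) (N : nat) (c g : R) :
  0 <= c -> 0 <= g ->
  (forall n, (n < N)%N -> e n.+1 <= (1 + c) * e n + g) ->
  e N <= (1 + c) ^+ N * (e 0%N + N%:R * g).
Proof.
move=> c0 g0 step; have c1 : 1 <= 1 + c by rewrite lerDl.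
suff H n : (n <= N)%N -> e n <= (1 + c) ^+ n * (e 0%N + n%:R * g) by exact: H.
elim: n => [_|n IH nN]; first by rewrite expr0 mul1r mul0r addr0.
apply: le_trans (step n nN) _.
have -> : (1 + c) ^+ n.+1 * (e 0%N + n.+1%:R * g) =
    (1 + c) * ((1 + c) ^+ n * (e 0%N + n%:R * g)) + (1 + c) ^+ n.+1 * g.
  by rewrite -natr1 exprS; ring.
apply: lerD; last by rewrite ler_peMl// exprn_ege1.
by apply: ler_wpM2l; [exact: le_trans ler01 c1|exact/IH/ltnW].
Qed.

Unset Implicit Arguments.

Theorem corollary3p4 (R : realType) (B C T : R) :
  exists K : R, 0 < K /\
  forall (d1 d2 : measure_display)
    (T1 : measurableType d1) (T2 : measurableType d2)
    (m1 : {sigma_finite_measure set T1 -> \bar R})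
    (m2 : {sigma_finite_measure set T2 -> \bar R})
    (r N : nat) (dt eta : R)
    (L : ((T1 * T2)%type -> R) -> ((T1 * T2)%type -> R))
    (f0 : (T1 * T2)%type -> R) (f : R -> (T1 * T2)%type -> R)
    (X : nat -> 'I_r -> T1 -> R) (S : nat -> 'M[R]_r)
    (V : nat -> 'I_r -> T2 -> R),
    let y := fun n => lowrank (X n) (S n) (V n) in
    let delta0 := L2norm (m1 \x m2)%E (f0 - y 0%N) in
    0 < dt -> T = N%:R * dt ->
    L2_bounded_lipschitz (m1 \x m2)%E L B C ->
    tangent_residual_le m1 m2 r L eta ->
    f0 \in Lfun (m1 \x m2)%E 2%:E ->
    L2_ode_solution (m1 \x m2)%E L 0 T f0 f ->
    best_approx m1 m2 r f0 (y 0%N) ->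
    gap_scheme m1 m2 L dt N X S V ->
    L2norm (m1 \x m2)%E (y N - f T) <= K * (dt + eta + delta0).
Proof.
pose C' := Num.max C 0; have C'0 : 0 <= C' by rewrite le_max lexx orbT.
(* [5 * B + 2] comes from the GAP step and one more [B] from the exact solution. The absolute value
   is taken because [B] is known to be nonnegative only once [L] is given. *)
pose D := C' * (6 * `|B| + 2).
have D0 : 0 <= D by rewrite mulr_ge0 ?addr_ge0 ?mulr_ge0.
(* The exponential absorbs the Gronwall factor, and [(1 + |T|) * (1 + D)] the initial error and the
   accumulated local errors. *)
exists (expR (C' * T) * ((1 + `|T|) * (1 + D))); split.
  by rewrite !mulr_gt0 ?expR_gt0 ?ltr_pwDl.
move=> d1 d2 T1 T2 m1 m2 r N dt eta L f0 f X S V y delta0 dt0 TE LBC0 Leta f0L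
  fode [_ _] [mani steps].
have LBC : L2_bounded_lipschitz (m1 \x m2)%E L B C' by exact: L2_bounded_lipschitz_max.
have B0 := L2_bounded_lipschitz_ge0 LBC; have [LL LB Llip] := LBC.
have yL n : (n <= N)%N -> y n \in Lfun (m1 \x m2)%E 2%:E.
  by move=> /mani[_ _ []].
have tdt n : (n <= N)%N -> n%:R * dt <= T by move=> nN; rewrite TE ler_pM2r// ler_nat.
have t0 n : 0 <= n%:R * dt by rewrite mulr_ge0// ltW.
have fL n : (n <= N)%N -> f (n%:R * dt) \in Lfun (m1 \x m2)%E 2%:E.
  by move=> nN; have [+ _ _] := fode; apply; rewrite in_itv /= t0 tdt.
have eta0 : 0 <= eta.
  have [XO VO Hy] := mani 0%N (leq0n N).
  apply: le_trans (L2norm_ge0 _ _) (Leta _ _ _ _ Hy XO VO _).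
  exact: ae_eq_refl.
pose e n := L2norm (m1 \x m2)%E (y n - f (n%:R * dt)).
pose g := dt * (D * dt + eta).
have g0 : 0 <= g by rewrite mulr_ge0 ?addr_ge0 ?mulr_ge0// ltW.
have stepe n : (n < N)%N -> e n.+1 <= (1 + C' * dt) * e n + g.
  move=> nN; have nN' := ltnW nN.
  have [XO VO _] := mani n nN'.
  have dtE : n.+1%:R * dt - n%:R * dt = dt by rewrite -natr1; ring.
  have lt_t : n%:R * dt < n.+1%:R * dt by rewrite ltr_pM2r// ltr_nat.
  have ystep := gap_step_euler C'0 LBC Leta lt_t XO VO (steps n nN).
  have fode_n := L2_ode_solution_sub (t0 n) (tdt _ nN) fode.
  have [_ fstep] := euler_step C'0 LBC fode_n (fL _ nN') (ltW lt_t) (fL _ nN)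
    (ae_eq_refl _ _ _).
  rewrite dtE in ystep fstep.
  have [[[ynL ySL] fnL] fSL] := (yL _ nN', yL _ nN, fL _ nN', fL _ nN).
  (* Both sequences are compared with their explicit Euler steps; the steps themselves differ by the
     old error and a Lipschitz term. *)
  have -> : e n.+1 = L2norm (m1 \x m2)%E ((y n.+1 - y n - dt *: L (y n)) +
      (- (f (n.+1%:R * dt) - f (n%:R * dt) - dt *: L (f (n%:R * dt))) +
       ((y n - f (n%:R * dt)) + dt *: (L (y n) - L (f (n%:R * dt)))))).
    congr L2norm; rewrite scalerBr; apply/funext => z; rewrite !fctE; ring.
  have LynL := LL _ ynL; have LfnL := LL _ fnL.
  have -> : (1 + C' * dt) * e n + g = C' * (5 * B + 2) * dt ^+ 2 + dt * eta +
      (C' * B * dt ^+ 2 + (e n + dt * (C' * e n))).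
    by rewrite /g /D ger0_norm//; ring.
  apply: L2normD_le; [in_L2|rewrite -scaleN1r; in_L2|by []|].
  apply: L2normD_le; [rewrite -scaleN1r; in_L2|in_L2|by rewrite L2normN|].
  apply: L2normD_le; [in_L2|in_L2|by []|].
  by rewrite L2normZ ?gtr0_norm ?ler_pM2l//; [exact: Llip|in_L2].
have e0 : e 0%N <= delta0.
  have y0L := yL 0%N (leq0n N); have f00L := fL 0%N (leq0n N).
  have [_ ff0 _] := fode; rewrite /e /delta0 mul0r in f00L *.
  apply: le_trans (L2norm_dist_triangle y0L f0L f00L) _.
  rewrite (L2norm_distC _ f0 (f 0)) (ae_eq_L2norm f00L f0L ff0) addr0.
  by rewrite L2norm_distC.
have := discrete_gronwall (N := N) (mulr_ge0 C'0 (ltW dt0)) g0 stepe.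
rewrite {1}/e -TE; move=> /le_trans; apply.
have T0 : 0 <= T by rewrite TE mulr_ge0// ltW.
(* From [1 + x <= expR x], raised to the power [N], with [N%:R * dt = T]. *)
have pow : (1 + C' * dt) ^+ N <= expR (C' * T).
  rewrite TE mulrCA mulrC expRM_natl.
  by rewrite lerXn2r ?nnegrE ?expR_ge0 ?addr_ge0 ?mulr_ge0 ?(ltW dt0)// expR_ge1Dx.
have delta00 : 0 <= delta0 by exact: L2norm_ge0.
have e0_ge0 : 0 <= e 0%N by exact: L2norm_ge0.
rewrite -mulrA; apply: ler_pM => //.
- by rewrite exprn_ge0// addr_ge0// mulr_ge0// ltW.
- by rewrite addr_ge0// mulr_ge0.
rewrite (ger0_norm T0) /g mulrA -TE.
apply: le_trans (_ : delta0 + T * (D * dt + eta) <= _); first by rewrite lerD2r.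
(* The difference of the two sides expands into a sum of products of nonnegative quantities. *)
rewrite -subr_ge0.
have -> : (1 + T) * (1 + D) * (dt + eta + delta0) -
    (delta0 + T * (D * dt + eta)) =
    dt + eta + D * (dt + eta + delta0) + T * (dt + delta0 + D * (eta + delta0)).
  by ring.
by rewrite !(addr_ge0, mulr_ge0)// ltW.
Qed.
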